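(* Let $T$ be a tree, let $\mu$ be a positive function on $T$, and let $\varphi$ be a self-map of $T$ such that $C_\varphi$ is bounded on $L_\mu^\infty$. If $\varphi$ has infinite range, then $$\|C_\varphi\|_e = \lim_{N \to \infty} \sup_{|\varphi(v)| \geq N} \frac{\mu(v)}{\mu(\varphi(v))}.$$ Furthermore, $C_\varphi$ is compact on $L_\mu^\infty$ if and only if $\varphi$ has finite range or $$\lim_{N \to \infty} \sup_{|\varphi(v)| \geq N} \frac{\mu(v)}{\mu(\varphi(v))} = 0.$$
   Context: A tree $T$ is a locally finite, connected, simply-connected graph, identified as a set with its set of vertices; it is assumed to have no terminal vertices (a vertex is terminal if it has a unique neighbor), hence to be infinite, and it is rooted at a vertex $o$. The length $|v|$ of a vertex $v$ is the number of edges on the unique path from $o$ to $v$. A function on $T$ is a complex-valued function on the set of vertices. For a positive function $\mu: T \to (0,\infty)$ (the weight), $L_\mu^\infty$ is the Banach space of all functions $f$ on $T$ with $\|f\|_\mu = \sup_{v \in T} \mu(v)|f(v)| < \infty$. For an arbitrary self-map $\varphi$ of (the vertex set of) $T$, the composition operator is $C_\varphi f = f \circ \varphi$; it is bounded on $L_\mu^\infty$ if it maps $L_\mu^\infty$ into itself as a bounded linear operator. For a bounded operator $A$ on a Banach space $X$, the essential norm is $\|A\|_e = \inf\{\|A - K\| : K \text{ is a compact operator on } X\}$. The supremum $\sup_{|\varphi(v)| \geq N}$ is taken over all $v \in T$ with $|\varphi(v)| \ge N$; this set is nonempty for every $N$ when $\varphi$ has infinite range. *)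

(* Defs.v *)
From HB Require Import structures.
From mathcomp Require Import all_boot all_order all_algebra complex.
From mathcomp Require Import all_classical all_reals all_analysis.

Set Implicit Arguments.
Unset Strict Implicit.
Unset Printing Implicit Defensive.
Import Order.TTheory GRing.Theory Num.Theory ComplexField.Normc.

Local Open Scope classical_set_scope.
Local Open Scope ring_scope.
Local Open Scope complex_scope.

Section Trees.
Variables (V : choiceType) (e : rel V).

Definition connected_graph : Prop :=
  forall x y, exists p, path e x p /\ last x p = y.

(* A cycle of size 2 only runs back and forth along an edge. *)
Definition simply_connected_graph : Prop :=
  forall c, ucycle e c -> (size c <= 2)%N.

Definition locally_finite_graph : Prop :=
  forall x, finite_set [set y | e x y].

Definition terminal_vertex (x : V) : Prop := exists! y, e x y.

(* Infiniteness is listed because the one-vertex graph has no vertex with a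
   unique neighbour. *)
Record is_tree : Prop := IsTree {
  tree_irreflexive : irreflexive e;
  tree_symmetric : symmetric e;
  tree_connected : connected_graph;
  tree_simply_connected : simply_connected_graph;
  tree_locally_finite : locally_finite_graph;
  tree_no_terminal : forall x, ~ terminal_vertex x;
  tree_infinite : infinite_set [set: V] }.

(* In [path e o p] the list [p] omits the starting point [o], so [size p] is
   the number of edges.  In a tree exactly one [p] qualifies. *)
Definition tree_length (o v : V) : nat :=
  size (xget [::] [set p | [/\ path e o p, uniq (o :: p) & last o p = v]]).

End Trees.

Section WeightedSupSpace.
Variables (R : realType) (V : Type) (mu : V -> {posnum R}).

Definition weighted_mod (f : V -> R[i]) (v : V) : R := (mu v)%:num * normc (f v).

Definition weighted_norm (f : V -> R[i]) : R := sup (range (weighted_mod f)).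

Definition weighted_bounded : {pred V -> R[i]} :=
  [pred f | `[< has_ubound (range (weighted_mod f)) >]].

Record linfty := Linfty {
  linfty_fun :> V -> R[i];
  linfty_bounded : linfty_fun \in weighted_bounded }.

HB.instance Definition _ := [isSub for linfty_fun].
HB.instance Definition _ := [Choice of linfty by <:].

Lemma weighted_mod_ge0 f v : 0 <= weighted_mod f v.
Proof. by rewrite mulr_ge0// /normc; case: (f v) => a b; rewrite sqrtr_ge0. Qed.

Lemma weighted_modD f g v :
  weighted_mod (f + g) v <= weighted_mod f v + weighted_mod g v.
Proof. by rewrite -mulrDr ler_wpM2l// le_normcD. Qed.

Lemma weighted_modZ a f v : weighted_mod (a *: f) v = normc a * weighted_mod f v.
Proof. by rewrite /weighted_mod normcM mulrCA. Qed.

Lemma weighted_boundedP (f : V -> R[i]) :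
  reflect (exists M, forall v, weighted_mod f v <= M) (f \in weighted_bounded).
Proof.
apply: (iffP (asboolP _)) => -[M fM]; exists M; first by move=> v; apply: fM; exists v.
by move=> _ [v _ <-].
Qed.

Fact weighted_bounded_submod : submod_closed weighted_bounded.
Proof.
split.
  apply/weighted_boundedP; exists 0 => v.
  by rewrite /weighted_mod (_ : (0 : V -> R[i]) v = 0)// normc0 mulr0.
move=> a f g /weighted_boundedP[M fM] /weighted_boundedP[N gN].
apply/weighted_boundedP; exists (normc a * M + N) => v.
apply: le_trans (weighted_modD _ _ _) _; rewrite lerD// weighted_modZ.
by rewrite ler_wpM2l// /normc; case: (a) => x y; rewrite sqrtr_ge0.
Qed.

HB.instance Definition _ :=
  GRing.isSubmodClosed.Build _ _ weighted_bounded weighted_bounded_submod.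
HB.instance Definition _ := [SubChoice_isSubLmodule of linfty by <:].

Lemma weighted_mod_le (f : linfty) v : weighted_mod f v <= weighted_norm f.
Proof.
case/weighted_boundedP: (linfty_bounded f) => M fM.
by apply: ub_le_sup; [exists M => _ [w _ <-]|exists v].
Qed.

Lemma weighted_norm_le (f : V -> R[i]) M :
  0 <= M -> (forall v, weighted_mod f v <= M) -> weighted_norm f <= M.
Proof.
move=> M0 fM; have [[v]|V0] := pselect (inhabited V).
  by apply: ge_sup; [exists (weighted_mod f v), v|move=> _ [w _ <-]].
suff -> : weighted_norm f = 0 by [].
rewrite /weighted_norm (_ : range _ = set0) ?sup0//.
by apply/seteqP; split=> // x [v]; case: V0; exists.
Qed.

Lemma weighted_norm_ge0 (f : linfty) : 0 <= weighted_norm f.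
Proof.
have [[v]|V0] := pselect (inhabited V).
  exact: le_trans (weighted_mod_ge0 f v) (weighted_mod_le f v).
rewrite /weighted_norm (_ : range _ = set0) ?sup0//.
by apply/seteqP; split=> // x [v]; case: V0; exists.
Qed.

(* A norm on a module over [R[i]] is [R[i]]-valued in this library. *)
Definition linfty_norm (f : linfty) : R[i] := (weighted_norm f)%:C.

Fact linfty_normD f g : linfty_norm (f + g) <= linfty_norm f + linfty_norm g.
Proof.
rewrite /linfty_norm -rmorphD/= lecR; apply: weighted_norm_le.
  by rewrite addr_ge0// weighted_norm_ge0.
by move=> v; apply: le_trans (weighted_modD _ _ _) _; rewrite lerD// weighted_mod_le.
Qed.

Fact linfty_normZ (a : R[i]) f : linfty_norm (a *: f) = `|a| * linfty_norm f.
Proof.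
have normc_ge0 (b : R[i]) : 0 <= normc b.
  by rewrite /normc; case: b => x y; rewrite sqrtr_ge0.
have le b (g : linfty) : weighted_norm (b *: g : linfty) <= normc b * weighted_norm g.
  apply: weighted_norm_le; first by rewrite mulr_ge0// weighted_norm_ge0.
  by move=> v; rewrite weighted_modZ ler_wpM2l// weighted_mod_le.
rewrite (_ : `|a| = (normc a)%:C)// /linfty_norm -rmorphM/=; congr _%:C.
apply/eqP; rewrite eq_le (le a f) andTb; have [->|a0] := eqVneq a 0.
  by rewrite normc0 mul0r; exact: (weighted_norm_ge0 (0 *: f)).
have na : 0 < normc a.
  by rewrite lt_neqAle normc_ge0 andbT eq_sym; apply: contra_neq a0 => /eq0_normc.
have := le a^-1 (a *: f); rewrite scalerK// normcV => fle.
by rewrite mulrC -ler_pdivlMr// mulrC.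
Qed.

Fact linfty_norm_eq0 f : linfty_norm f = 0 -> f = 0.
Proof.
move=> [f0]; apply/val_inj/funext => v /=; apply: eq0_normc; apply/eqP.
have: weighted_mod f v <= 0 by rewrite -f0 weighted_mod_le.
rewrite /weighted_mod pmulr_rle0// => fv.
by rewrite eq_le fv /normc; case: (linfty_fun f v) => a b; rewrite sqrtr_ge0.
Qed.

HB.instance Definition _ := Lmodule_isNormed.Build R[i] linfty
  linfty_normD linfty_normZ linfty_norm_eq0.

End WeightedSupSpace.

Section Operators.
Variables (R : realType) (X : normedModType R[i]).
Implicit Types A K : X -> X.

Definition bounded_operator A : Prop :=
  linear A /\ exists M : R, forall x, `|A x| <= M%:C * `|x|.

Definition compact_operator K : Prop :=
  bounded_operator K /\ precompact (K @` [set x | `|x| <= 1]).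

(* [complex.Re] only brings the nonnegative real [`|A x| : R[i]] back to [R]. *)
Definition operator_norm A : R :=
  sup [set complex.Re `|A x| | x in [set x | `|x| <= 1]].

Definition essential_norm A : R :=
  inf [set operator_norm (A \- K) | K in [set K | compact_operator K]].

End Operators.

Section CompositionOperator.
Variables (R : realType) (V : Type) (mu : V -> {posnum R}) (phi : V -> V).

(* When [f \o phi] leaves the space the value is the junk [0]; this is excluded
   by [composition_bounded]. *)
Definition composition_op (f : linfty mu) : linfty mu :=
  insubd (0 : linfty mu) (f \o phi).

Definition composition_bounded : Prop :=
  (forall f : linfty mu, f \o phi \in weighted_bounded mu) /\
  bounded_operator composition_op.

End CompositionOperator.

(* The supremum is taken in the extended reals. *)
Definition tail_sup (R : realType) (V : choiceType) (e : rel V) (o : V)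
    (mu : V -> {posnum R}) (phi : V -> V) (N : nat) : \bar R :=
  ereal_sup [set ((mu v)%:num / (mu (phi v))%:num)%:E
            | v in [set v | (N <= tree_length e o (phi v))%N]].

(* Main.v *)
Require Import Defs.
From HB Require Import structures.
From mathcomp Require Import all_boot all_order all_algebra complex ring.
From mathcomp Require Import finmap all_classical all_reals all_analysis.

Set Implicit Arguments.
Unset Strict Implicit.
Unset Printing Implicit Defensive.
Import Order.TTheory GRing.Theory Num.Theory.

Local Open Scope classical_set_scope.
Local Open Scope ring_scope.

(** Write [rho v] for the ratio [mu v / mu (phi v)].  Testing [C_phi] on the
unit vector supported at [phi v] shows that [rho] is bounded by the norm of
[C_phi]; conversely, if [rho <= M] on a set of vertices, then the part of
[C_phi f] living on this set has norm at most [M] times that of [f].  The two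
inequalities between the essential norm and the limit of the tail suprema of
[rho] refine these two observations.

Upper bound.  Split [C_phi] as [K + (C_phi - K)], where [K f] agrees with
[f \o phi] on the preimage of a ball of the tree and is zero elsewhere.  The
remainder has norm at most the tail supremum of [rho].  The operator [K] is
compact, for a reason that covers every case needed
([compact_restricted_comp]): the unit ball sits inside a product of real
intervals, which is compact for pointwise convergence, and a restricted
composition operator is continuous from this product to the norm topology as
soon as [rho] is small outside the preimage of a finite set, because then
finitely many coordinates control the norm of the image up to a small error.
The same criterion applied to [C_phi] itself gives its compactness when [phi]
has finite range or the tail suprema tend to zero.

Lower bound.  A compact operator [K] makes the normalized indicators of single
vertices arbitrarily small along every infinite set of vertices
([compact_operator_vanishes]).  Indeed, infinitely many of their images lie
close to one another; a sum of [n] of these indicators still has norm at most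
one, its image is close to [n] times a single image, and so a single image has
norm about [norm K / n] at most.  If all tail suprema exceed [r], infinitely
many vertices [w] are of the form [w = phi v] with [rho v > r], and [C_phi]
sends the normalized indicator of each of them to a function of norm more than
[r]; so [C_phi - K] has norm at least [r].

Since the tail suprema decrease, they converge to their infimum, and the two
bounds identify it with the essential norm. *)

(** * Finite balls of a tree *)

Section Balls.
Variables (V : choiceType) (e : rel V) (o : V).

Lemma finite_path_ends : locally_finite_graph e -> forall N,
  finite_set [set v | exists p, [/\ path e o p, (size p <= N)%N & last o p = v]].
Proof.
move=> lf; elim=> [|N IHN].
  apply: sub_finite_set (finite_set1 o) => v [p [_]].
  by rewrite leqn0 size_eq0 => /eqP -> /= ->.
apply: (@sub_finite_set _ _ ([set o] `|` \bigcup_(u in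
  [set v | exists p, [/\ path e o p, (size p <= N)%N & last o p = v]])
   [set y | e u y])); last first.
  by rewrite finite_setU; split; [exact: finite_set1|exact: bigcup_finite].
move=> v [p [+ + <-]]; case/lastP: p => [|p x]; first by left.
rewrite rcons_path size_rcons last_rcons ltnS => /andP[pp ex] sp; right.
by exists (last o p) => //; exists p.
Qed.

(** Connectedness makes [tree_length] the size of an actual path, so that a ball
consists of end points of short paths; local finiteness bounds those. *)
Lemma finite_tree_ball : connected_graph e -> locally_finite_graph e ->
  forall N, finite_set [set v | (tree_length e o v < N)%N].
Proof.
move=> conn lf N; apply: sub_finite_set (finite_path_ends lf N) => v /=.
rewrite /tree_length; case: xgetP => [p _ [pp _ lp] sp|noP _].
  by exists p; split => //; exact: ltnW.
have [p [pp lp]] := conn o v; exfalso.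
by case: (shortenP pp) lp => q pq uq _ lq; apply: (noP q).
Qed.

End Balls.

(** * Moduli, norms and operators on the weighted space *)

Section ComplexModulus.
Variable R : realType.
Import ComplexField.Normc.
Local Open Scope complex_scope.

Lemma normc_ge0 (z : R[i]) : 0 <= normc z.
Proof. by case: z => a b; rewrite sqrtr_ge0. Qed.

Lemma normc_Re_le (z : R[i]) : `|complex.Re z| <= normc z.
Proof. by case: z => a b /=; rewrite -sqrtr_sqr ler_wsqrtr// lerDl sqr_ge0. Qed.

Lemma normc_Im_le (z : R[i]) : `|complex.Im z| <= normc z.
Proof. by case: z => a b /=; rewrite -sqrtr_sqr ler_wsqrtr// lerDr sqr_ge0. Qed.

Lemma normc_le_ReIm (a b : R) : normc (a +i* b) <= `|a| + `|b|.
Proof.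
rewrite /normc -[leRHS]ger0_norm ?addr_ge0// -sqrtr_sqr ler_wsqrtr//.
by rewrite sqrrD !real_normK ?num_real// -addrA lerD2l lerDr mulrn_wge0// mulr_ge0.
Qed.

Lemma normc_real (x : R) : 0 <= x -> normc x%:C = x.
Proof. by move=> x0; rewrite /= expr0n addr0 sqrtr_sqr ger0_norm. Qed.

End ComplexModulus.

Section LinearMaps.
Variables (S : pzRingType) (X Y : lmodType S) (A : X -> Y).
Hypothesis linA : linear A.

Lemma linear_D : {morph A : f g / f + g}.
Proof. by move=> f g; have := linA 1 f g; rewrite !scale1r. Qed.

Lemma linear_0 : A 0 = 0.
Proof. by apply: (addrI (A 0)); rewrite -linear_D !addr0. Qed.

Lemma linear_Z a f : A (a *: f) = a *: A f.
Proof. by have := linA a f 0; rewrite linear_0 !addr0. Qed.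

End LinearMaps.

Section WeightedNorm.
Variables (R : realType) (V : Type) (mu : V -> {posnum R}).
Implicit Types (f g : linfty mu).
Import ComplexField.Normc.
Local Open Scope complex_scope.

Local Notation wnorm f := (weighted_norm mu (linfty_fun (f : linfty mu))).

Lemma wnormE f : `|f| = (wnorm f)%:C. Proof. by []. Qed.

Lemma wnormD f g : wnorm (f + g) <= wnorm f + wnorm g.
Proof. by rewrite -lecR rmorphD/=; exact: linfty_normD. Qed.

Lemma wnormN f : wnorm (- f) = wnorm f.
Proof. by have := normrN f; rewrite !wnormE => -[]. Qed.

Lemma wnormB f g : wnorm (f - g) <= wnorm f + wnorm g.
Proof. by rewrite (le_trans (wnormD _ _))// wnormN. Qed.

Lemma wnorm0 : wnorm (0 : linfty mu) = 0.
Proof. by have := normr0 (linfty mu); rewrite !wnormE => -[]. Qed.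

Lemma wnormMn f n : wnorm (f *+ n) = n%:R * wnorm f.
Proof.
rewrite -[LHS]/(complex.Re `|f *+ n|) normrMn wnormE mulr_natl.
by rewrite -(rmorphMn (real_complex R)).
Qed.

Lemma wnorm_ball f : [set x : linfty mu | `|x| <= 1] f = (wnorm f <= 1).
Proof. by rewrite /= wnormE -[1]/(1%:C) lecR. Qed.

Implicit Types A K : linfty mu -> linfty mu.

Lemma bounded_operatorP A : bounded_operator A <->
  linear A /\ exists2 M, 0 <= M & forall f, wnorm (A f) <= M * wnorm f.
Proof.
split=> -[lA [M]]; last first.
  by move=> _ AM; split=> //; exists M => f; rewrite !wnormE -rmorphM lecR.
move=> AM; split=> //; exists (Num.max 0 M); first by rewrite le_max lexx.
move=> f; rewrite (@le_trans _ _ (M * wnorm f))//.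
  by have := AM f; rewrite !wnormE -rmorphM lecR.
by rewrite ler_wpM2r ?weighted_norm_ge0// le_max lexx orbT.
Qed.

Lemma bounded_operatorB A K :
  bounded_operator A -> bounded_operator K -> bounded_operator (A \- K).
Proof.
move=> /bounded_operatorP[lA [M M0 AM]] /bounded_operatorP[lK [M' M'0 KM]].
apply/bounded_operatorP; split.
  by move=> a f g /=; rewrite lA lK scalerBr opprD addrACA.
exists (M + M'); first exact: addr_ge0.
by move=> f /=; rewrite (le_trans (wnormB _ _))// mulrDl lerD.
Qed.

Lemma operator_normE A :
  operator_norm A = sup [set wnorm (A f) | f in [set f : linfty mu | wnorm f <= 1]].
Proof.
rewrite /operator_norm; congr (sup (_ @` _)).
by apply/funext => f; rewrite wnorm_ball.
Qed.

Lemma operator_norm_ge A f :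
  bounded_operator A -> wnorm f <= 1 -> wnorm (A f) <= operator_norm A.
Proof.
move=> /bounded_operatorP[_ [M M0 AM]] f1; rewrite operator_normE.
apply: ub_le_sup; last by exists f.
by exists M => _ [g g1 <-]; rewrite (le_trans (AM g))// ler_piMr.
Qed.

Lemma operator_norm_le A M :
  (forall f, wnorm f <= 1 -> wnorm (A f) <= M) -> operator_norm A <= M.
Proof.
move=> AM; rewrite operator_normE; apply: ge_sup => [|_ [f f1 <-]]; last exact: AM.
by exists (wnorm (A 0)), 0 => //=; rewrite wnorm0.
Qed.

Lemma operator_norm_ge0 A : bounded_operator A -> 0 <= operator_norm A.
Proof.
move=> bA; apply: le_trans (operator_norm_ge bA (f := 0) _).
  exact: weighted_norm_ge0.
by rewrite wnorm0.
Qed.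

Lemma essential_norm_le A K : bounded_operator A -> compact_operator K ->
  essential_norm A <= operator_norm (A \- K).
Proof.
move=> bA cK; apply: ge_inf; last by exists K.
exists 0 => _ [K' [bK' _] <-].
exact/operator_norm_ge0/bounded_operatorB.
Qed.

End WeightedNorm.

(** * Compact operators on normalized indicators *)

Section NormalizedIndicators.
Variables (R : realType) (V : choiceType) (mu : V -> {posnum R}).
Import ComplexField.Normc.
Local Open Scope complex_scope.
Local Notation wnorm f := (weighted_norm mu (linfty_fun (f : linfty mu))).

Implicit Types (s : seq V) (K : linfty mu -> linfty mu).

(** Dividing by the weight gives [weighted_mod] the value one at every vertex of
[s], whatever the number of these vertices. *)
Definition indicator_fun s (v : V) : R[i] :=
  if v \in s then ((mu v)%:num^-1)%:C else 0.

Lemma weighted_mod_indicator s v :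
  weighted_mod mu (indicator_fun s) v = (v \in s)%:R.
Proof.
rewrite /weighted_mod /indicator_fun; case: ifP => _; last by rewrite normc0 mulr0.
by rewrite normc_real// mulfV.
Qed.

Fact indicator_bounded s : indicator_fun s \in weighted_bounded mu.
Proof.
by apply/weighted_boundedP; exists 1 => v; rewrite weighted_mod_indicator lern1 leq_b1.
Qed.

Definition normalized_indicator s : linfty mu := Linfty (indicator_bounded s).

Lemma normalized_indicator_le1 s : wnorm (normalized_indicator s) <= 1.
Proof.
apply: weighted_norm_le => // v.
by rewrite weighted_mod_indicator lern1 leq_b1.
Qed.

Lemma normalized_indicator_cons w s : w \notin s ->
  normalized_indicator (w :: s) =
  normalized_indicator [:: w] + normalized_indicator s.
Proof.
move=> ws; apply/val_inj/funext => v.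
rewrite -[RHS]/(indicator_fun [:: w] v + indicator_fun s v) /= /indicator_fun inE.
rewrite mem_seq1; case: eqVneq => [->|_] /=; last by rewrite add0r.
by rewrite (negbTE ws) addr0.
Qed.

(** If the images of the vertices of [s] are [eps]-close to [g], the image of the
indicator of [s], which is their sum, is [size s * eps]-close to [g *+ size s]. *)
Lemma clustered_images K (eps : R) s w0 : linear K -> uniq s ->
  (forall w, w \in s ->
    wnorm (K (normalized_indicator [:: w]) - K (normalized_indicator [:: w0]))
      <= eps) ->
  (size s)%:R * wnorm (K (normalized_indicator [:: w0])) <=
  wnorm (K (normalized_indicator s)) + (size s)%:R * eps.
Proof.
move=> lK us Keps; set g := K (normalized_indicator [:: w0]).
have sumK : wnorm (K (normalized_indicator s) - g *+ size s) <=
    (size s)%:R * eps.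
  elim: s us Keps => [_ _|w s IHs /andP[ws us] Keps].
    rewrite (_ : normalized_indicator [::] = 0); last exact/val_inj/funext.
    by rewrite (linear_0 lK) /= mulr0n subr0 wnorm0 mul0r.
  rewrite normalized_indicator_cons// (linear_D lK) -[size (w :: s)]/(size s).+1.
  rewrite mulrS -[(size s).+1]add1n natrD opprD addrACA mulrDl mul1r.
  apply: (le_trans (wnormD _ _)); rewrite lerD//; first by rewrite Keps// mem_head.
  by apply: IHs => // w' w's; rewrite Keps// inE w's orbT.
rewrite -wnormMn; set h := g *+ _ in sumK *.
have -> : h = K (normalized_indicator s) - (K (normalized_indicator s) - h).
  by rewrite opprB addrC subrK.
by apply: (le_trans (wnormB _ _)); rewrite lerD2l.
Qed.

(** This replaces the weak convergence to zero of the normalized indicators: the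
images of a sequence of them have a cluster point, so infinitely many images
are close together; by [clustered_images] and the bound on the norm of any
finite sum of indicators, such images are small. *)
Lemma compact_operator_vanishes K (W : set V) (eps : R) :
  compact_operator K -> infinite_set W -> 0 < eps ->
  exists2 w, W w & wnorm (K (normalized_indicator [:: w])) <= eps.
Proof.
move=> [/bounded_operatorP[lK [M M0 KM]]]; rewrite precompactE => cK Winf eps0.
have /infiniteP/card_leP[j] := Winf.
pose w n : V := val (j (to_setT n)).
have Ww n : W (w n) by exact/set_mem/valP.
have winj : injective w.
  by move=> a b /val_inj/inj-/(_ (mem_set I) (mem_set I))/(congr1 val).
pose u n := K (normalized_indicator [:: w n]).
have uK : \forall n \near \oo, closure (K @` [set x : linfty mu | `|x| <= 1]) (u n).
  apply: nearW => n; apply: subset_closure; exists (normalized_indicator [:: w n]) => //.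
  by rewrite wnorm_ball; exact: normalized_indicator_le1.
have [g [_ gclu]] := cK (u @ \oo) _ uK.
pose d := eps / 4.
have d0 : 0 < d by rewrite divr_gt0.
(* Two points of the ball of radius [eps / 4] around the cluster point [g] are at
   distance [eps / 2]; the other half of [eps] absorbs [M / m]. *)
pose near_g := [set n | wnorm (g - u n) < d].
have near_g_inf : infinite_set near_g.
  move=> /finite_fsetP[X XE].
  pose N := \max_(n <- (X : seq nat)) n.+1.
  have uN : \forall n \near \oo, (u @` [set n | (N <= n)%N]) (u n).
    by exists N => // n /= Nn; exists n.
  have gd : nbhs g (ball g d%:C) by apply: nbhsx_ballx; rewrite ltcR.
  have [_ [[n Nn <-]]] := gclu _ _ uN gd.
  rewrite -ball_normE/= wnormE ltcR => und.
  have : near_g n by [].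
  rewrite XE /= => nX.
  have := leq_trans (@leq_bigmax_seq _ (X : seq nat) xpredT succn n nX isT) Nn.
  by rewrite ltnn.
pose m := (Num.truncn (M / (eps / 2))).+1.
have [B Bg mB] := infinite_set_fset m near_g_inf.
have Bn n : n \in (B : seq nat) -> wnorm (g - u n) < d by move=> nB; exact: Bg.
case: (B : seq nat) (fset_uniq B) mB Bn => [//|n0 s] us ms sg.
exists (w n0); first exact: Ww.
have us' : uniq (map w (n0 :: s)) by rewrite map_inj_uniq.
have close v : v \in map w (n0 :: s) ->
    wnorm (K (normalized_indicator [:: v]) - u n0) <= eps / 2.
  move=> /mapP[n nB ->]; have -> : K (normalized_indicator [:: w n]) - u n0 =
    (g - u n0) - (g - u n) by rewrite opprB [RHS]addrC subrKA.
  apply: le_trans (wnormB _ _) _; rewrite (splitr (eps / 2)) -mulrA -invfM -natrM lerD//.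
    by rewrite ltW// sg// mem_head.
  by rewrite ltW// sg.
have := clustered_images lK us' close; rewrite size_map.
have /le_trans KM1 : wnorm (K (normalized_indicator (map w (n0 :: s)))) <= M.
  by apply: le_trans (KM _) _; rewrite ler_piMr// normalized_indicator_le1.
set S : R := (size (n0 :: s))%:R.
have S0 : 0 < S by rewrite ltr0n.
have MS : M <= S * (eps / 2).
  rewrite -ler_pdivrMr ?divr_gt0// ltW// (lt_le_trans (truncnS_gt _))// ler_nat.
  exact: ms.
move=> H; rewrite -(ler_pM2l S0) (splitr eps) mulrDr (le_trans H)// lerD2r.
exact: KM1.
Qed.

End NormalizedIndicators.

(** * Real coordinates on the unit ball *)

Section RealCoordinates.
Variables (R : realType) (V : choiceType) (mu : V -> {posnum R}).
Import ComplexField.Normc numFieldNormedType.Exports.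
Local Open Scope complex_scope.

(** Coordinates are indexed by a vertex and by a boolean that selects the real
([true]) or imaginary part, so that a product of segments of [R] can stand for
the unit ball. *)
Definition pair_fun (p : V * bool -> R) (v : V) : R[i] := p (v, true) +i* p (v, false).

Definition coordinate_box : set (forall _ : V * bool, R) :=
  [set p | forall i, `[- (mu i.1)%:num^-1, (mu i.1)%:num^-1]%classic (p i)].

Definition coordinate_space : topologicalType :=
  prod_topology (fun _ : V * bool => R : topologicalType).

Lemma compact_coordinate_box :
  compact (coordinate_box : set coordinate_space).
Proof.
by apply: (@tychonoff _ (fun=> R : topologicalType)
  (fun i => `[- (mu i.1)%:num^-1, (mu i.1)%:num^-1]%classic)) => i; exact: segment_compact.
Qed.

Definition of_coordinates (p : V * bool -> R) : linfty mu :=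
  insubd (0 : linfty mu) (pair_fun p).

Lemma coordinate_boxP p : coordinate_box p -> forall i, `|p i| <= (mu i.1)%:num^-1.
Proof. by move=> bp i; have := bp i; rewrite /= in_itv/= ler_norml. Qed.

Lemma of_coordinatesE p v : coordinate_box p -> of_coordinates p v = pair_fun p v.
Proof.
move=> /coordinate_boxP bp; rewrite /of_coordinates insubdK//.
apply/weighted_boundedP; exists 2 => {}v; rewrite /weighted_mod mulrC -ler_pdivlMr//.
by rewrite (le_trans (normc_le_ReIm _ _))// mulrDl mul1r lerD// bp.
Qed.

(** The box is larger than the ball (its points have norm at most two), but
covering the ball is enough for precompactness. *)
Lemma of_coordinates_ball :
  [set f : linfty mu | `|f| <= 1] `<=` of_coordinates @` coordinate_box.
Proof.
move=> f; rewrite wnorm_ball => f1.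
pose p (i : V * bool) : R := if i.2 then complex.Re (f i.1) else complex.Im (f i.1).
have bp : coordinate_box p.
  move=> [v b]; rewrite /= in_itv/= -ler_norml /p /= -[leRHS]mul1r ler_pdivlMr// mulrC.
  rewrite (@le_trans _ _ (weighted_mod mu f v))//; last first.
    exact: le_trans (weighted_mod_le f v) f1.
  by rewrite /weighted_mod ler_wpM2l//; case: b; [exact: normc_Re_le|exact: normc_Im_le].
exists p => //; apply/val_inj/funext => v.
rewrite -[LHS]/(of_coordinates p v) of_coordinatesE//.
by rewrite /pair_fun /p /=; case: (f v).
Qed.

Lemma near_coordinates (p : coordinate_space) (d : V -> R) (s : seq V) :
  (forall w, 0 < d w) ->
  \forall q \near nbhs p, forall w, w \in s -> forall b, `|p (w, b) - q (w, b)| <= d w.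
Proof.
move=> d0; elim: s => [|w s IHs]; first exact: nearW.
have near_b b : \forall q \near nbhs p, `|p (w, b) - q (w, b)| <= d w.
  have cp := @proj_continuous _ (fun _ : V * bool => R : topologicalType) (w, b) p.
  have cpb : nbhs p ((fun q : coordinate_space => q (w, b)) @^-1` ball (p (w, b)) (d w)).
    exact: (cp _ (nbhsx_ballx (p (w, b)) (d w) (d0 w))).
  apply: filterS cpb => q.
  by rewrite -ball_normE => /ltW.
near=> q => w'; rewrite inE => /orP[/eqP ->|w's].
  by case; near: q; exact: near_b.
by move: w' w's; near: q.
Unshelve. all: by end_near. Qed.

End RealCoordinates.

(** * Restricted composition operators *)

Section RestrictedComposition.
Variables (R : realType) (V : choiceType) (mu : V -> {posnum R}) (phi : V -> V).
Import ComplexField.Normc numFieldNormedType.Exports.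
Local Open Scope complex_scope.
Implicit Types (A : set V) (f h : linfty mu).
Local Notation wnorm f := (weighted_norm mu (linfty_fun (f : linfty mu))).

(** The composition operator followed by the restriction to the preimage of [A]
under [phi].  Taking [A] finite gives the compact approximations of [C_phi],
and the complement of [A] gives the error. *)
Definition restricted_comp A f : linfty mu :=
  insubd (0 : linfty mu)
    (fun v => if `[< A (phi v) >] then f (phi v) else 0).

Definition ratio_vanishes_on A : Prop := forall eps : R, 0 < eps ->
  exists2 F, finite_set F & forall v, A (phi v) -> ~ F (phi v) ->
    (mu v)%:num <= eps * (mu (phi v))%:num.

Lemma composition_opE : composition_op phi = restricted_comp setT.
Proof.
apply/funext => f; congr insubd; apply/funext => v.
by rewrite ifT//; exact/asboolP.
Qed.

Variable C : R.
Hypothesis muC : forall v, (mu v)%:num <= C * (mu (phi v))%:num.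

Lemma restricted_comp_fun A f v :
  restricted_comp A f v = if `[< A (phi v) >] then f (phi v) else 0.
Proof.
rewrite /restricted_comp insubdK//; apply/weighted_boundedP.
exists (C * wnorm f) => {}v; have C0 : 0 <= C.
  by rewrite -(pmulr_lge0 _ (gt0 (mu (phi v)))) (le_trans _ (muC v)).
rewrite /weighted_mod; case: asboolP => _; last first.
  by rewrite normc0 mulr0 mulr_ge0// weighted_norm_ge0.
rewrite (le_trans (ler_wpM2r (normc_ge0 _) (muC v)))//.
by rewrite -mulrA ler_wpM2l// weighted_mod_le.
Qed.

Lemma linear_restricted_comp A : linear (restricted_comp A).
Proof.
move=> a f g; apply/val_inj/funext => v.
rewrite -[RHS]/(a *: restricted_comp A f v + restricted_comp A g v).
rewrite -[LHS]/(restricted_comp A (a *: f + g) v) !restricted_comp_fun.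
by case: asboolP => // _; rewrite scaler0 addr0.
Qed.

Lemma restricted_compT_sub A f :
  restricted_comp setT f - restricted_comp A f = restricted_comp (~` A) f.
Proof.
apply/val_inj/funext => v.
rewrite -[LHS]/(restricted_comp setT f v - restricted_comp A f v).
rewrite -[RHS]/(restricted_comp (~` A) f v) !restricted_comp_fun.
rewrite ifT; last exact/asboolP.
by rewrite asbool_neg; case: asboolP => _ /=; rewrite ?subrr ?subr0.
Qed.

Lemma restricted_comp_le A h (M : R) : 0 <= M ->
  (forall v, A (phi v) -> (mu v)%:num * normc (h (phi v)) <= M) ->
  wnorm (restricted_comp A h) <= M.
Proof.
move=> M0 hM; apply: weighted_norm_le => // v.
rewrite /weighted_mod restricted_comp_fun.
by case: asboolP => [/hM//|_]; rewrite normc0 mulr0.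
Qed.

Lemma restricted_comp_norm A h (M : R) : 0 <= M ->
  (forall v, A (phi v) -> (mu v)%:num <= M * (mu (phi v))%:num) ->
  wnorm (restricted_comp A h) <= M * wnorm h.
Proof.
move=> M0 muM; apply: restricted_comp_le => [|v Av].
  by rewrite mulr_ge0// weighted_norm_ge0.
rewrite (le_trans (ler_wpM2r (normc_ge0 _) (muM v Av)))//.
by rewrite -mulrA ler_wpM2l// weighted_mod_le.
Qed.

Lemma bounded_restricted_comp A : 0 <= C -> bounded_operator (restricted_comp A).
Proof.
move=> C0; apply/bounded_operatorP; split; first exact: linear_restricted_comp.
by exists C => // f; apply: restricted_comp_norm.
Qed.

Lemma restricted_compB A f h :
  restricted_comp A f - restricted_comp A h = restricted_comp A (f - h).
Proof.
have lA := linear_restricted_comp A.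
by rewrite (linear_D lA) -[in RHS]scaleN1r (linear_Z lA) scaleN1r.
Qed.

(** Over the finite set [F] where the ratio may be large, pointwise proximity of
the coordinates makes the images close; elsewhere the ratio is so small that the
mere boundedness of the box suffices. *)
Lemma restricted_comp_continuous A : 0 <= C -> ratio_vanishes_on A ->
  {within (coordinate_box mu : set (coordinate_space R V)),
    continuous (restricted_comp A \o of_coordinates mu)}.
Proof.
move=> C0 vanish; apply/subspace_continuousP => p bp.
apply/cvgrPdist_le => -[e b]; rewrite ltcE/= => /andP[/eqP -> e0] {b}.
(* Two points of the box differ by at most [4 / mu w] at [w], which the bound
   [e / 4] on the ratio turns into [e]. *)
have [F /finite_fsetP[X ->] FX] := vanish (e / 4) (divr_gt0 e0 (ltr0Sn _ 3)).
have C1 : 0 < C + 1 by rewrite ltr_pwDr.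
(* The real and imaginary parts contribute [d w] each, and the ratio at most [C];
   [C + 1] replaces [C] because [C] may be zero. *)
pose d w := e / 2 / (C + 1) / (mu w)%:num.
have d0 w : 0 < d w by rewrite !divr_gt0.
near=> q; have bq : coordinate_box mu q by near: q; exact: withinT.
have qp w : w \in (X : seq V) -> forall b, `|p (w, b) - q (w, b)| <= d w.
  by move: w; near: q; apply: cvg_within; exact: near_coordinates.
rewrite /= restricted_compB wnormE lecR; apply: restricted_comp_le => [|v Av].
  exact: ltW.
set w := phi v.
rewrite -[linfty_fun _ w]/(of_coordinates mu p w - of_coordinates mu q w).
rewrite !of_coordinatesE//.
have -> : pair_fun p w - pair_fun q w =
    (p (w, true) - q (w, true)) +i* (p (w, false) - q (w, false)) by [].
have [wX|wX] := boolP (w \in (X : seq V)).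
  have hd : normc ((p (w, true) - q (w, true)) +i* (p (w, false) - q (w, false)))
      <= d w + d w.
    by rewrite (le_trans (normc_le_ReIm _ _))// lerD// qp.
  apply: le_trans (ler_pM _ (normc_ge0 _) (muC v) hd) _ => //.
  have -> : C * (mu (phi v))%:num * (d w + d w) = e * (C / (C + 1)).
    rewrite /d -/w -mulrDl -mulrDl -splitr; field.
    by rewrite gt_eqF// gt_eqF.
  by rewrite ler_piMr ?(ltW e0)// ler_pdivrMr// mul1r lerDl.
have h4 : normc ((p (w, true) - q (w, true)) +i* (p (w, false) - q (w, false)))
    <= 4 / (mu w)%:num.
  rewrite (le_trans (normc_le_ReIm _ _))// (_ : 4 = 1 + 1 + (1 + 1)); last by ring.
  rewrite mulrDl mulrDl mul1r lerD// (le_trans (ler_normB _ _))// lerD//;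
    first [exact: (coordinate_boxP bp)|exact: (coordinate_boxP bq)].
apply: le_trans (ler_pM _ (normc_ge0 _) (FX _ Av _) h4) _ => //.
  exact/negP.
by rewrite -/w le_eqVlt; apply/orP; left; apply/eqP; field; rewrite gt_eqF.
Unshelve. all: by end_near. Qed.

Lemma compact_restricted_comp A : 0 <= C -> ratio_vanishes_on A ->
  compact_operator (restricted_comp A).
Proof.
move=> C0 vanish; split; first exact: bounded_restricted_comp.
have := continuous_compact (restricted_comp_continuous C0 vanish)
  (@compact_coordinate_box _ _ mu).
move=> /(compact_precompact (@norm_hausdorff _ _)); apply: precompact_subset.
by move=> _ [f /of_coordinates_ball[p bp <-] <-]; exists p.
Qed.

End RestrictedComposition.

(** * Norm estimates for the composition operator *)

Section CompositionNorm.
Variables (R : realType) (V : choiceType) (mu : V -> {posnum R}) (phi : V -> V).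
Hypothesis Cphi_bounded : composition_bounded mu phi.
Import ComplexField.Normc.
Implicit Types (K : linfty mu -> linfty mu).
Local Notation wnorm f := (weighted_norm mu (linfty_fun (f : linfty mu))).
Local Notation Cphi := (@composition_op R V mu phi).

Lemma ratio_le_composition v :
  (mu v)%:num / (mu (phi v))%:num <= wnorm (Cphi (normalized_indicator mu [:: phi v])).
Proof.
apply: le_trans (weighted_mod_le _ v).
rewrite /weighted_mod /composition_op insubdK; last exact: Cphi_bounded.1.
by rewrite /= /indicator_fun mem_head normc_real.
Qed.

Lemma composition_ratio_bounded :
  exists2 C, 0 <= C & forall v, (mu v)%:num <= C * (mu (phi v))%:num.
Proof.
have /bounded_operatorP[_ [C C0 KC]] := Cphi_bounded.2.
exists C => // v; rewrite -ler_pdivrMr// (le_trans (ratio_le_composition v))//.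
by apply: le_trans (KC _) _; rewrite ler_piMr// normalized_indicator_le1.
Qed.

(** On the normalized indicator of a well chosen vertex [phi v] of the infinite
set, [C_phi] has norm at least [r] while [K] is negligible. *)
Lemma ratio_le_operator_norm K (r : R) : compact_operator K ->
  infinite_set [set phi v | v in [set v | r < (mu v)%:num / (mu (phi v))%:num]] ->
  r <= operator_norm (Cphi \- K).
Proof.
move=> cK Winf; apply/ler_addgt0Pr => eps eps0.
have [_ [v rv <-] Kv] := compact_operator_vanishes cK Winf eps0.
rewrite (le_trans (ltW rv))// (le_trans (ratio_le_composition v))//.
set f := normalized_indicator mu _ in Kv *.
rewrite -[Cphi f](subrK (K f)); apply: le_trans (wnormD _ _) _; rewrite lerD//.
apply: (operator_norm_ge (A := Cphi \- K)); last exact: normalized_indicator_le1.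
by apply: bounded_operatorB; [exact: Cphi_bounded.2|exact: cK.1].
Qed.

Lemma compact_composition : ratio_vanishes_on mu phi setT -> compact_operator Cphi.
Proof.
move=> vanish; have [C C0 muC] := composition_ratio_bounded.
by rewrite composition_opE; exact: (compact_restricted_comp muC C0).
Qed.

(** Subtracting the compact restriction of [C_phi] to the preimage of [F] leaves
its restriction to the preimage of the complement, of norm at most [t]. *)
Lemma essential_norm_composition_le (F : set V) (t : R) : finite_set F -> 0 <= t ->
  (forall v, ~ F (phi v) -> (mu v)%:num <= t * (mu (phi v))%:num) ->
  essential_norm Cphi <= t.
Proof.
move=> finF t0 Ft; have [C C0 muC] := composition_ratio_bounded.
have cF : compact_operator (restricted_comp (mu := mu) phi F).
  by apply: (compact_restricted_comp muC C0) => eps eps0; exists F.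
apply: le_trans (essential_norm_le Cphi_bounded.2 cF) _.
apply: operator_norm_le => f f1.
have -> : (Cphi \- restricted_comp phi F) f = restricted_comp phi (~` F) f.
  by rewrite composition_opE; exact: (restricted_compT_sub muC).
by apply: le_trans (restricted_comp_norm muC _ t0 Ft) _; rewrite ler_piMr.
Qed.

(** An infimum of reals is bounded below by [r] only if the set is nonempty; the
restriction of [C_phi] to the empty set provides a compact operator. *)
Lemma le_essential_norm (r : R) :
  (forall K, compact_operator K -> r <= operator_norm (Cphi \- K)) ->
  r <= essential_norm Cphi.
Proof.
move=> rK; have [C C0 muC] := composition_ratio_bounded.
apply: lb_le_inf => [|_ [K cK <-]]; last exact: rK.
set K := restricted_comp (mu := mu) phi set0.
exists (operator_norm (Cphi \- K)), K => //.
by apply: (compact_restricted_comp muC C0) => eps eps0; exists set0.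
Qed.

Lemma essential_norm_compact : compact_operator Cphi -> essential_norm Cphi = 0.
Proof.
move=> cC; apply/eqP; rewrite eq_le; apply/andP; split.
  apply: le_trans (essential_norm_le Cphi_bounded.2 cC) _.
  apply: operator_norm_le => f _.
  by rewrite (_ : (Cphi \- Cphi) f = 0) ?wnorm0//; exact: subrr.
apply: le_essential_norm => K [bK _].
by apply/operator_norm_ge0/bounded_operatorB => //; exact: Cphi_bounded.2.
Qed.

End CompositionNorm.

(** * Tail suprema *)

Section TailSuprema.
Variables (R : realType) (V : choiceType) (e : rel V) (o : V).
Variables (mu : V -> {posnum R}) (phi : V -> V).
Local Notation tail := (tail_sup e o mu phi).

Lemma tail_sup_cvg : tail N @[N --> \oo] --> ereal_inf (range tail).
Proof.
apply: ereal_nonincreasing_cvgn => N M NM; apply: le_ereal_sup => _ [v Mv <-].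
by exists v => //; exact: leq_trans NM Mv.
Qed.

Lemma ratio_le_tail N (t : R) v : (tail N <= t%:E)%E ->
  ~ (tree_length e o (phi v) < N)%N -> (mu v)%:num <= t * (mu (phi v))%:num.
Proof.
move=> Nt /negP; rewrite -leqNgt => Nv; rewrite -ler_pdivrMr// -lee_fin.
by apply: le_trans Nt; apply: ereal_sup_ubound; exists v.
Qed.

(** Vertices of a finite set have bounded length, and a tail supremum beyond this
bound produces a further vertex [phi v] with a large ratio. *)
Lemma infinite_large_ratio (r : R) : (forall N, (r%:E < tail N)%E) ->
  infinite_set [set phi v | v in [set v | r < (mu v)%:num / (mu (phi v))%:num]].
Proof.
move=> rt /finite_fsetP[X XE].
have /ereal_sup_gt[_ [v Nv <-]] := rt (\max_(w <- (X : seq V)) (tree_length e o w).+1).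
rewrite lte_fin => rv; have : [set` X] (phi v) by rewrite -XE; exists v.
move=> /= vX.
have := leq_trans (@leq_bigmax_seq _ (X : seq V) xpredT
  (fun w => (tree_length e o w).+1) _ vX isT) Nv.
by rewrite ltnn.
Qed.

(** An infinite range leaves every ball, so that the supremum is over a nonempty
set and is not minus infinity. *)
Lemma tail_sup_ge0 N : finite_set [set v | (tree_length e o v < N)%N] ->
  infinite_set (range phi) -> (0 <= tail N)%E.
Proof.
move=> finN inf; have [_ [[v _ <-] /negP]] := infinite_setN0 (infinite_setD inf finN).
rewrite -leqNgt => Nv.
by apply: le_ereal_sup_tmp; exists ((mu v)%:num / (mu (phi v))%:num)%:E => //; exists v.
Qed.

End TailSuprema.

(** * The essential norm *)

Theorem theorem4p3 (R : realType) (V : choiceType) (e : rel V) (o : V)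
    (treeV : is_tree e) (mu : V -> {posnum R}) (phi : V -> V)
    (Cphi_bounded : composition_bounded mu phi) :
  (infinite_set (range phi) ->
     tail_sup e o mu phi N @[N --> \oo] -->
       (essential_norm (@composition_op R V mu phi))%:E) /\
  (compact_operator (@composition_op R V mu phi) <->
     finite_set (range phi) \/
     tail_sup e o mu phi N @[N --> \oo] --> 0%:E).
Proof.
set E := essential_norm _; set u := tail_sup e o mu phi.
have finball := finite_tree_ball o (tree_connected treeV) (tree_locally_finite treeV).
have ucvg : u N @[N --> \oo] --> ereal_inf (range u) by exact: tail_sup_cvg.
have ess : infinite_set (range phi) -> u N @[N --> \oo] --> E%:E.
  move=> inf; suff <- : ereal_inf (range u) = E%:E by [].
  apply/eqP; rewrite eq_le; apply/andP; split; last first.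
    apply: le_ereal_inf_tmp => _ [N _ <-].
    have := tail_sup_ge0 mu (finball N) inf; rewrite -/u.
    case uN : (u N) => [t| |]//; rewrite ?leey// !lee_fin => t0.
    apply: (essential_norm_composition_le Cphi_bounded (finball N) t0) => v.
    by apply: ratio_le_tail; rewrite -/u uN.
  have rE r : (r%:E < ereal_inf (range u))%E -> r <= E.
    move=> ru; apply: (le_essential_norm Cphi_bounded) => K cK.
    apply: (ratio_le_operator_norm Cphi_bounded cK).
    apply: (@infinite_large_ratio _ _ e o) => N; apply: (lt_le_trans ru).
    by apply: ereal_inf_lbound; exists N.
  case: (ereal_inf (range u)) rE => [t| |] rE; rewrite ?leNye//.
    rewrite lee_fin leNgt; apply/negP => Et.
    by have := rE _ (midf_lt Et).2; rewrite leNgt (midf_lt Et).1.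
  by have := rE (E + 1) (ltry _); rewrite gerDl ler10.
split=> //; split=> [cC|].
  have [fin|inf] := pselect (finite_set (range phi)); [by left|right].
  by rewrite -(essential_norm_compact Cphi_bounded cC); exact: ess.
move=> fin_or_lim; apply: (compact_composition Cphi_bounded) => eps eps0.
case: fin_or_lim => [fin|u0].
  by exists (range phi) => // v _ []; exists v.
have inf0 : ereal_inf (range u) = 0%:E by apply: cvg_unique ucvg u0; exact: ereal_hausdorff.
have /ereal_inf_lt[_ [N _ <-] uN] : (ereal_inf (range u) < eps%:E)%E.
  by rewrite inf0 lte_fin.
by exists [set w | (tree_length e o w < N)%N] => // v _; exact/ratio_le_tail/ltW.
Qed.
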